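(* Let $n>1$ be an integer. Then $$\frac{1+\ln(n)}{n} > 1-\frac{n!}{\prod_{i=0}^{n-1}\left(\frac{n}{n-1}+i\right)}.$$
   Context: $\ln$ denotes the natural logarithm. *)

(* Defs.v *)
From mathcomp Require Import all_boot all_order all_algebra.
From mathcomp Require Import reals exp.

(* Main.v *)
Require Import Defs.
From mathcomp Require Import all_boot all_order all_algebra.
From mathcomp Require Import reals exp.
From mathcomp Require Import ring lra.
Import Order.TTheory GRing.Theory Num.Theory.
Local Open Scope ring_scope.

(** Put [c = n / (n - 1)] and [d = c - 1 = 1 / (n - 1)], so that the product is
    [(1 + d) (2 + d) ... (n + d)]. Splitting off the factor
    [1 / (1 + d) = (n - 1) / n] exactly and using
    [(1 - x_2) ... (1 - x_n) >= 1 - x_2 - ... - x_n] with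
    [x_i = d / (i + d) < d / i] for the others gives
    [n! / ((1 + d) ... (n + d)) > (1 - d (1/2 + ... + 1/n)) / (1 + d)],
    and [1/2 + ... + 1/n <= ln n]. *)

(** Apply [ln (1 + x) <= x] at [x = - 1 / (m + 2)], where [1 + x = (m + 1) / (m + 2)]. *)
Lemma ln_natS_ge (R : realType) (m : nat) :
  ln (m.+1%:R : R) + m.+2%:R^-1 <= ln m.+2%:R.
Proof.
have m1_gt0 : (0 : R) < m.+1%:R by rewrite ltr0n.
have m2_gt0 : (0 : R) < m.+2%:R by rewrite ltr0n.
have ratioE : m.+1%:R / m.+2%:R = 1 + - m.+2%:R^-1 :> R.
  by rewrite -(natr1 m.+1); field; rewrite nat1r natr1 gt_eqF.
have inv_gt : -1 < - (m.+2%:R^-1 : R).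
  by rewrite ltrN2 invf_lt1 // ltr1n.
have := le_ln1Dx inv_gt; rewrite -ratioE ln_div ?posrE //.
by rewrite lerBlDr -lerBrDr [- _ + _]addrC.
Qed.

(** Keeping [c] independent of [m] lets inductions on [m] run with [c] fixed, although the theorem
    takes [c = n / (n - 1)]. *)
Definition fact_ratio {R : fieldType} (c : R) (m : nat) : R :=
  m`!%:R / \prod_(0 <= i < m) (c + i%:R).

Lemma fact_ratio1 (R : fieldType) (c : R) : fact_ratio c 1 = c^-1.
Proof. by rewrite /fact_ratio big_nat1 addr0 factS mulr1n mul1r. Qed.

Lemma fact_ratioS (R : fieldType) (c : R) (m : nat) :
  fact_ratio c m.+1 = fact_ratio c m * (m.+1%:R / (c + m%:R)).
Proof.
by rewrite /fact_ratio factS mulnC natrM big_nat_recr //= invfM mulrACA.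
Qed.

Lemma fact_ratio_ge0 (R : realFieldType) (c : R) (m : nat) :
  0 <= c -> 0 <= fact_ratio c m.
Proof.
move=> c_ge0; rewrite divr_ge0 ?ler0n // prodr_ge0 // => i _.
by rewrite addr_ge0 ?ler0n.
Qed.

(** Multiplying by [c] cancels the factor [1 / c]; the others, [(i + 1) / (c + i)], are below 1. *)
Lemma fact_ratio_mul_le1 (R : realFieldType) (c : R) (m : nat) :
  1 < c -> fact_ratio c m.+1 * c <= 1.
Proof.
move=> c_gt1; have c_gt0 : 0 < c := lt_trans ltr01 c_gt1.
elim: m => [|m IHm].
  by rewrite fact_ratio1 mulVf ?gt_eqF.
apply: le_trans IHm; rewrite fact_ratioS ler_pM2r // ler_piMr //.
  exact/fact_ratio_ge0/ltW.
rewrite ler_pdivrMr ?mul1r; last by rewrite addr_gt0 ?ltr0n.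
by rewrite -[leLHS]nat1r lerD2r ltW.
Qed.

Lemma fact_ratioS_gt (R : realFieldType) (c : R) (m : nat) :
  1 < c ->
  fact_ratio c m.+1 * c - (c - 1) / m.+2%:R < fact_ratio c m.+2 * c.
Proof.
move=> c_gt1; have q_le1 := fact_ratio_mul_le1 _ c m c_gt1.
rewrite [fact_ratio c m.+2]fact_ratioS.
have -> : c + m.+1%:R = (c - 1) + m.+2%:R by rewrite -(natr1 m.+1); ring.
have d_gt0 : 0 < c - 1 by rewrite subr_gt0.
have a_gt0 : (0 : R) < m.+2%:R by rewrite ltr0n.
move: (fact_ratio _ _) q_le1 (m.+2%:R : R) a_gt0 => q q_le1 a a_gt0.
have da_gt0 : 0 < c - 1 + a by rewrite addr_gt0.
(* The new factor is [1 - x] with [x = (c - 1) / (c - 1 + a)]. The loss [q * c * x] is at most [x]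
   since [q * c <= 1], and [x < (c - 1) / a]. *)
have -> : q * (a / (c - 1 + a)) * c = q * c - q * c * ((c - 1) / (c - 1 + a)).
  by field; rewrite gt_eqF.
rewrite ltrD2l ltrN2.
apply: (@le_lt_trans _ _ ((c - 1) / (c - 1 + a))).
  by rewrite ler_piMl // ltW // divr_gt0.
by rewrite ltr_pM2l // ltf_pV2 ?posrE // ltrDr.
Qed.

Lemma fact_ratioS_gt_ln (R : realType) (c : R) (m : nat) :
  1 < c -> 1 - (c - 1) * ln m.+1%:R <= fact_ratio c m.+1 * c ->
  1 - (c - 1) * ln m.+2%:R < fact_ratio c m.+2 * c.
Proof.
move=> c_gt1 q_ge; apply: le_lt_trans (fact_ratioS_gt _ c m c_gt1).
apply: le_trans (lerB q_ge (lexx _)).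
rewrite -addrA -opprD -mulrDr lerD2l lerN2.
by rewrite ler_pM2l ?subr_gt0 // ln_natS_ge.
Qed.

(** At [m = 0] both sides equal 1, so the bound cannot be strict here; each induction step gains
    strictness. *)
Lemma fact_ratio_ge_ln (R : realType) (c : R) (m : nat) :
  1 < c -> 1 - (c - 1) * ln m.+1%:R <= fact_ratio c m.+1 * c.
Proof.
move=> c_gt1; elim: m => [|m IHm]; last exact/ltW/fact_ratioS_gt_ln.
rewrite ln1 mulr0 subr0 fact_ratio1 mulVf //.
by rewrite gt_eqF // (lt_trans ltr01).
Qed.

Theorem theorem6 (R : realType) (n : nat) (hn : (1 < n)%N) :
  (1 + ln (n%:R : R)) / n%:R >
    1 - n`!%:R / \prod_(0 <= i < n) (n%:R / (n%:R - 1) + i%:R).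
Proof.
have n1_gt0 : (0 : R) < n%:R - 1 by rewrite subr_gt0 ltr1n.
have n_gt0 : (0 : R) < n%:R by rewrite ltr0n ltnW.
rewrite -/(fact_ratio _ _); set c := n%:R / (n%:R - 1).
have c_gt1 : 1 < c by rewrite ltr_pdivlMr // mul1r gtrBl.
have : 1 - (c - 1) * ln n%:R < fact_ratio c n * c.
  (* Since [n = m + 2], the last factor supplies the strict inequality. *)
  case: n hn @c c_gt1 {n1_gt0 n_gt0} => [|[|m]] // _ c c_gt1.
  exact/fact_ratioS_gt_ln/fact_ratio_ge_ln.
have c_gt0 := lt_trans ltr01 c_gt1.
rewrite -ltr_pdivrMr //.
(* Here [1 / c = 1 - 1 / n] and [(c - 1) / c = 1 / n]. *)
have -> : (1 - (c - 1) * ln n%:R) / c = 1 - (1 + ln n%:R) / n%:R.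
  by rewrite /c; field; rewrite !gt_eqF.
lra.
Qed.
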